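(* Let $S$ be a quasilocal ring, let $K$ be an $S$-module, let $C$ be a multiplicatively closed subset of nonzerodivisors of $S$ that are also nonzerodivisors on $K$, and let $R$ be a (necessarily quasilocal) subring of $S$ that is twisted by $K$ along $C$. Suppose that $I$ is an ideal of $R$ that is contracted from $S$ and meets $C$ (i.e. $I\cap C\neq\emptyset$). Let $n>0$. If there exists a finitely generated ideal $J$ of $S$ with $J\subseteq IS$ and $(IS)^{n+1}=J(IS)^n$, then there exists an ideal $J'$ of $R$ with $J'\subseteq I$, $I^{n+2}=J'I^{n+1}$ and $\mu_R(J')=\mu_S(J)$.
   Context: All rings are commutative with identity; a quasilocal ring is a ring with a unique maximal ideal (not necessarily Noetherian). An ideal $I$ of a subring $R\subseteq S$ is contracted from $S$ if $I=IS\cap R$. For an ideal $J$ of a ring $A$, $\mu_A(J)$ is the minimal number of generators of $J$. A derivation $D:B\to L$ from a ring $B$ to a $B$-module $L$ is an additive map with $D(st)=sD(t)+tD(s)$; $\ker D$ is its additive kernel. Twisted subring: let $S$ be a ring, $K$ an $S$-module, $C$ a multiplicatively closed subset of nonzerodivisors of $S$ that are also nonzerodivisors on $K$, and view $S\subseteq S_C$, $K\subseteq K_C$ (localizations at $C$). A subring $R$ of $S$ is twisted by $K$ along $C$ if there is a derivation $D:S_C\to K_C$ with $D(c)=0$ for all $c\in C$ such that (a) $R=S\cap D^{-1}(K)$; (b) $D(S_C)$ generates $K_C$ as an $S_C$-module; (c) $S\subseteq \ker D+cS$ for all $c\in C$. In particular $C\subseteq R$. *)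

(* Defs.v *)
From HB Require Import structures.
From mathcomp Require Import all_boot all_algebra.
From mathcomp Require Import boolp classical_sets.

Set Implicit Arguments.
Unset Strict Implicit.
Unset Printing Implicit Defensive.

Import GRing.Theory.

Local Open Scope classical_set_scope.
Local Open Scope ring_scope.

Section Span.
Context (B : comNzRingType) (V : lmodType B).

Definition lspan (A : set B) (X : set V) : set V :=
  [set v | exists (n : nat) (a : 'I_n -> B) (x : 'I_n -> V),
    [/\ forall k, A (a k), forall k, X (x k) & v = \sum_(k < n) a k *: x k]].

End Span.

(* A subring of S is a subset of S, and so is an ideal of a subring: in this
   section A stands for the subring; the ideals of S itself are obtained with
   A := setT. *)
Section Ideals.
Context (S : comNzRingType).
Implicit Types (A I J X : set S).

Definition subring A : Prop := subring_closed (mem A).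

Definition ideal A I : Prop :=
  [/\ I `<=` A, I 0,
      forall x y, I x -> I y -> I (x + y) &
      forall a x, A a -> I x -> I (a * x)].

Definition ideal_gen A X : set S := lspan A (X : set S^o).

Definition ideal_mul A I J : set S :=
  ideal_gen A [set x * y | x in I & y in J].

Fixpoint ideal_exp A I (n : nat) : set S :=
  if n is m.+1 then ideal_mul A I (ideal_exp A I m) else A.

Definition generated_by A J (m : nat) : Prop :=
  exists x : 'I_m -> S, (forall k, J (x k)) /\ J = ideal_gen A (range x).

Definition fin_gen A J : Prop := exists m, generated_by A J m.

Lemma fin_gen_asbool A J : fin_gen A J -> exists m, `[< generated_by A J m >].
Proof. by case=> m /asboolP; exists m. Qed.

(* None when J is not finitely generated. *)
Definition mu A J : option nat :=
  match pselect (fin_gen A J) with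
  | left h => Some (ex_minn (fin_gen_asbool h))
  | right _ => None
  end.

Definition contracted A I : Prop := I = ideal_gen setT I `&` A.

Definition maximal_ideal (M : set S) : Prop :=
  [/\ ideal setT M, M <> setT &
      forall N, ideal setT N -> M `<=` N -> N = M \/ N = setT].

Definition quasilocal : Prop := exists! M : set S, maximal_ideal M.

End Ideals.

Arguments quasilocal : clear implicits.

(* Localizations are unique up to unique isomorphism; the next two predicates
   say that a given map S -> SC, resp. K -> KC, is the canonical map to the
   localization at C. *)
Record is_ring_localization (S : comNzRingType) (C : set S)
    (SC : comNzRingType) (i : {rmorphism S -> SC}) : Prop := {
  ring_loc_unit : forall c, C c -> exists u, u * i c = 1;
  ring_loc_frac : forall x, exists s c, C c /\ i c * x = i s;
  ring_loc_ker : forall s, i s = 0 -> exists c, C c /\ c * s = 0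
}.

Record is_module_localization (S : comNzRingType) (C : set S)
    (SC : comNzRingType) (i : {rmorphism S -> SC})
    (K : lmodType S) (KC : lmodType SC)
    (j : {linear K -> KC | i \; *:%R}) : Prop := {
  module_loc_frac : forall y, exists k c, C c /\ i c *: y = j k;
  module_loc_ker : forall k, j k = 0 -> exists c, C c /\ c *: k = 0
}.

Definition derivation (B : comNzRingType) (L : lmodType B)
    (D : {additive B -> L}) : Prop :=
  forall s t, D (s * t) = s *: D t + t *: D s.

(* i : S -> SC and j : K -> KC are meant to be the localization maps. *)
Definition twisted (S : comNzRingType) (C : set S)
    (SC : comNzRingType) (i : {rmorphism S -> SC})
    (K : lmodType S) (KC : lmodType SC)
    (j : {linear K -> KC | i \; *:%R}) (R : set S) : Prop :=
  exists D : {additive SC -> KC},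
    [/\ derivation D /\ (forall c, C c -> D (i c) = 0),
        R = [set s | range j (D (i s))],
        lspan setT (range D) = setT &
        forall c, C c ->
          forall s, exists x t, D x = 0 /\ i s = x + i (c * t)].

(* Main.v *)
Require Import Defs.
From HB Require Import structures.
From mathcomp Require Import all_boot all_algebra.
From mathcomp Require Import boolp classical_sets.
From mathcomp Require Import ring.

Set Implicit Arguments.
Unset Strict Implicit.
Unset Printing Implicit Defensive.

Import GRing.Theory.

Local Open Scope classical_set_scope.
Local Open Scope ring_scope.

(** Let [D] be the derivation that twists [R], [A] the ring of the elements of
    [S] that [D] kills, and [c] an element of [I] and [C]. Then [A] is a subring
    of [R] that contains [C], and for every [e] in [C] it is dense in [S] modulo
    [e]: [S = A + e S]. So an element of [S] can be replaced by a constant at the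
    price of a multiple of an arbitrarily high power of [c], and if it is in
    [IS] and [e] is in [I], the constant is in the contraction of [IS], which
    is [I].

    Two remarks make these error terms harmless inside [R]. If [e t] is a
    constant then [t] is one, because [e] is invertible in the localization. If
    [e t] and [e t'] are in [R], then so is [e t t'] by the Leibniz rule, hence
    the product of two error terms from [R] is in [e R] ([const_mul]). The
    second remark shows that, modulo [e R], powers [I^(m+1)] are generated by
    products [p z] with [p] a constant of [I^m] and [z] in [I]
    ([exp_sub_of_constants]). This is where one factor is lost and the exponent
    [n+2] comes from: the equation [(IS)^(n+1) = J (IS)^n] is used on the
    constant factor only.

    Suppose that [c] is not invertible in [S]. Choose a minimal system of
    generators [x k] of [J] and write [x k = x' k + c^(n+2) t k] with constants
    [x' k] of [I]; let [J'] be the ideal of [R] generated by the [x' k]. Since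
    [c^(n+1)] is in [J] and [S] is quasilocal, the [x' k] still generate [J]
    over [S] ([ideal_gen_perturb]). This gives [mu_R(J') = mu_S(J)], because
    generators of [J'] generate [J = J' S]. A constant of [I^(n+1)] is
    [\sum_k x' k * w k] with [w k] in [(IS)^n]; splitting the [w k] into
    constants of [I^n] and multiples of [e] shows that it is in
    [J' I^n + e R], and therefore [I^(n+2)] is contained in
    [J' I^(n+1) + e R] ([exp_sub_reduction_modulo]). With [e = c^(n+3)] a
    Nakayama argument on the single element [c^(n+2)] removes the error
    ([exp_eq_reduction]).

    If [c] is invertible in [S], it is so in [R], and [J' = R] works. *)

(** * Ideals of a subring *)

Section IdealTheory.
Context (S : comNzRingType).
Implicit Types (A I J T W X : set S).

Lemma subring1 A : subring A -> A 1.
Proof. by case=> /set_mem. Qed.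

Lemma subringB A x y : subring A -> A x -> A y -> A (x - y).
Proof. by case=> _ AB _ Ax Ay; exact: set_mem (AB x y (mem_set Ax) (mem_set Ay)). Qed.

Lemma subringM A x y : subring A -> A x -> A y -> A (x * y).
Proof. by case=> _ _ AM Ax Ay; exact: set_mem (AM x y (mem_set Ax) (mem_set Ay)). Qed.

Lemma subring0 A : subring A -> A 0.
Proof. by move=> hA; rewrite -(subrr 1); apply: subringB => //; exact: subring1. Qed.

Lemma subringD A x y : subring A -> A x -> A y -> A (x + y).
Proof.
move=> hA Ax Ay; rewrite -[y]opprK -[- y]sub0r.
by do 2! [apply: subringB => //]; exact: subring0.
Qed.

Lemma subring_setT : subring ([set: S]).
Proof. by split=> [|x y _ _|x y _ _]; exact: (@mem_set _ setT _ I). Qed.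
Hint Resolve subring_setT : core.

Lemma subring_ideal A : subring A -> ideal A A.
Proof.
by move=> hA; split=> // *; [exact: subring0|exact: subringD|exact: subringM].
Qed.

Lemma idealB A I x y : subring A -> ideal A I -> I x -> I y -> I (x - y).
Proof.
move=> hA [_ _ ID IM] Ix Iy; apply: ID => //; rewrite -mulN1r; apply: IM => //.
by rewrite -sub0r; apply: subringB => //; [exact: subring0|exact: subring1].
Qed.

Lemma ideal_sum A I r (f : 'I_r -> S) :
  ideal A I -> (forall k, I (f k)) -> I (\sum_k f k).
Proof. by move=> [_ I0 ID _] If; apply: big_ind. Qed.

(** The span is defined with explicit finite sums; this is the induction
    principle that lets all later arguments avoid indices. *)
Lemma ideal_gen_min A X T :
  T 0 -> (forall x y, T x -> T y -> T (x + y)) ->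
  (forall a x, A a -> X x -> T (a * x)) -> ideal_gen A X `<=` T.
Proof.
move=> T0 TD TM v [m [a [x [Aa Xx ->]]]].
by apply: big_ind => // k _; apply: TM.
Qed.

Lemma ideal_gen_ideal A X : subring A -> X `<=` A -> ideal A (ideal_gen A X).
Proof.
move=> hA XA; split.
- apply: ideal_gen_min; [exact: subring0|by move=> *; exact: subringD|].
  by move=> a x Aa /XA Ax; exact: subringM.
- by exists 0%N, (fun=> 0), (fun=> 0); split=> [[]|[]|] //; rewrite big_ord0.
- move=> u v [m [a [x [Aa Xx ->]]]] [p [b [y [Ab Yy ->]]]].
  exists (m + p)%N, (fun k => match split k with inl i => a i | inr i => b i end),
    (fun k => match split k with inl i => x i | inr i => y i end); split.
  + by move=> k; case: (split k).
  + by move=> k; case: (split k).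
  + rewrite big_split_ord /=; congr (_ + _); apply: eq_bigr => k _.
      by rewrite -[lshift _ _]/(unsplit (inl k)) unsplitK.
    by rewrite -[rshift _ _]/(unsplit (inr k)) unsplitK.
- move=> b _ Ab [m [a [x [Aa Xx ->]]]].
  exists m, (fun k => b * a k), x; split=> // [k|]; first exact: subringM.
  by rewrite mulr_sumr; apply: eq_bigr => k _; exact: mulrA.
Qed.

Lemma mem_ideal_gen A X x : subring A -> X x -> ideal_gen A X x.
Proof.
move=> hA Xx; exists 1%N, (fun=> 1), (fun=> x); split=> // [_|].
  exact: subring1.
by rewrite big_ord1 scale1r.
Qed.

Lemma sub_ideal_gen A X I : ideal A I -> X `<=` I -> ideal_gen A X `<=` I.
Proof.
move=> [_ I0 ID IM] XI; apply: ideal_gen_min => // a x Aa /XI; exact: IM.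
Qed.

Lemma ideal_gen_rangeP A r (x : 'I_r -> S) v : subring A ->
  ideal_gen A (range x) v ->
  exists a : 'I_r -> S, (forall k, A (a k)) /\ v = \sum_k a k * x k.
Proof.
move=> hA; move: v; apply: ideal_gen_min.
- exists (fun=> 0); split=> [_|]; first exact: subring0.
  by rewrite big1 // => k _; rewrite mul0r.
- move=> _ _ [a [Aa ->]] [b [Ab ->]]; exists (fun k => a k + b k).
  split=> [k|]; first exact: subringD.
  by rewrite -big_split; apply: eq_bigr => k _; rewrite mulrDl.
- move=> b _ Ab [k _ <-]; exists (fun l => if l == k then b else 0).
  split=> [l|]; first by case: ifP => // _; exact: subring0.
  rewrite (bigD1 k) //= eqxx big1 ?addr0 // => l /negbTE ->.
  by rewrite mul0r.
Qed.

Lemma ideal_mul_ideal A I J : subring A -> I `<=` A -> J `<=` A ->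
  ideal A (ideal_mul A I J).
Proof.
move=> hA IA JA; apply: ideal_gen_ideal => // _ [x Ix [y Jy <-]].
by apply: subringM => //; [exact: IA|exact: JA].
Qed.

Lemma mem_ideal_mul A I J x y : subring A ->
  I x -> J y -> ideal_mul A I J (x * y).
Proof. by move=> hA Ix Jy; apply: mem_ideal_gen => //; exists x => //; exists y. Qed.

Lemma sub_ideal_mul A I J T : ideal A T ->
  (forall x y, I x -> J y -> T (x * y)) -> ideal_mul A I J `<=` T.
Proof.
by move=> hT IJT; apply: sub_ideal_gen => // _ [x Ix [y Jy <-]]; exact: IJT.
Qed.

Lemma ideal_mul_rangeP A r (x : 'I_r -> S) W v : subring A -> ideal A W ->
  ideal_mul A (ideal_gen A (range x)) W v ->
  exists w : 'I_r -> S, (forall k, W (w k)) /\ v = \sum_k x k * w k.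
Proof.
move=> hA [_ W0 WD WM]; move: v; apply: ideal_gen_min.
- by exists (fun=> 0); split=> //; rewrite big1 // => k _; rewrite mulr0.
- move=> _ _ [w [Ww ->]] [w' [Ww' ->]]; exists (fun k => w k + w' k).
  split=> [k|]; first exact: WD.
  by rewrite -big_split; apply: eq_bigr => k _; rewrite mulrDr.
- move=> b _ Ab [u /(ideal_gen_rangeP hA)[a [Aa ->]] [w Ww <-]].
  exists (fun k => b * (a k * w)); split=> [k|]; first exact/WM/WM.
  by rewrite mulr_suml mulr_sumr; apply: eq_bigr => k _; ring.
Qed.

Lemma ideal_exp_ideal A I m : subring A -> ideal A I -> ideal A (ideal_exp A I m).
Proof.
move=> hA hI; elim: m => [|m IHm] /=; first exact: subring_ideal.
by apply: ideal_mul_ideal => //; [case: hI|case: IHm].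
Qed.

Lemma ideal_exp_sub A B I J m : subring A -> subring B ->
  ideal A I -> ideal B J -> A `<=` B -> I `<=` J ->
  ideal_exp A I m `<=` ideal_exp B J m.
Proof.
move=> hA hB hI hJ AB IJ; elim: m => [|m IHm] //=.
have [_ P0 PD PM] := ideal_exp_ideal m.+1 hB hJ.
apply: ideal_gen_min => // a _ Aa [x Ix [y Iy <-]].
by apply: PM; [exact: AB|apply: mem_ideal_mul => //; [exact: IJ|exact: IHm]].
Qed.

Lemma mem_ideal_exp A I x m : subring A -> I x -> ideal_exp A I m (x ^+ m).
Proof.
move=> hA Ix; elim: m => [|m IHm]; first by rewrite expr0; exact: subring1.
by rewrite exprS; exact: mem_ideal_mul.
Qed.

Lemma ideal_exp_setT A m : subring A -> ideal_exp A A m = A.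
Proof.
move=> hA; elim: m => //= m ->; apply/seteqP; split.
  by case: (ideal_mul_ideal hA (@subset_refl _ A) (@subset_refl _ A)).
by move=> x Ax; rewrite -[x]mul1r; apply: mem_ideal_mul => //; exact: subring1.
Qed.

Lemma ideal_1 A I : ideal A I -> I 1 -> I = A.
Proof.
move=> [IA _ _ IM] I1; apply/seteqP; split=> // x Ax.
by rewrite -[x]mulr1; exact: IM.
Qed.

Lemma ideal_add_principal A I e : subring A -> ideal A I -> A e ->
  ideal A [set w + e * r | w in I & r in A].
Proof.
move=> hA [IA I0 ID IM] Ae; split.
- move=> _ [w Iw [r Ar <-]]; apply: subringD => //; first exact: IA.
  exact: subringM.
- by exists 0 => //; exists 0; [exact: subring0|rewrite mulr0 addr0].
- move=> _ _ [w Iw [r Ar <-]] [w' Iw' [r' Ar' <-]].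
  exists (w + w'); first exact: ID.
  by exists (r + r'); [exact: subringD|ring].
- move=> a _ Aa [w Iw [r Ar <-]].
  exists (a * w); first exact: IM.
  by exists (a * r); [exact: subringM|ring].
Qed.

Lemma muP A J r : mu A J = Some r <->
  generated_by A J r /\ forall m, generated_by A J m -> (r <= m)%N.
Proof.
rewrite /mu; case: pselect => [h|h]; last first.
  by split=> // -[hr _]; case: h; exists r.
case: ex_minnP => p /asboolP hp p_min; split=> [[<-]|[hr r_min]].
  by split=> // m hm; apply: p_min; exact/asboolP.
by congr Some; apply/eqP; rewrite eqn_leq r_min // p_min //; exact/asboolP.
Qed.

Lemma ideal_gen_extend A X : subring A ->
  ideal_gen setT (ideal_gen A X) = ideal_gen setT X.
Proof.
move=> hA; have hX := ideal_gen_ideal subring_setT (@subsetT _ X).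
apply/seteqP; split; apply: sub_ideal_gen => //; last first.
- by move=> x Xx; do 2! apply: mem_ideal_gen => //.
- exact: ideal_gen_ideal.
have [_ X0 XD XM] := hX; apply: ideal_gen_min => // a x _ Xx.
by apply: XM => //; exact: mem_ideal_gen.
Qed.

Lemma generated_by_extend A J m : subring A ->
  generated_by A J m -> generated_by setT (ideal_gen setT J) m.
Proof.
move=> hA [x [Jx ->]]; have XJ k : ideal_gen A (range x) (x k).
  by apply: mem_ideal_gen => //; exists k.
exists x; split=> [k|]; first exact: mem_ideal_gen.
exact: ideal_gen_extend.
Qed.

(** Generators over the subring also generate the extension, so extending an
    ideal cannot increase the number of generators; the converse inequality is
    the hypothesis. *)
Lemma mu_extension A J' J r : subring A -> mu setT J = Some r ->
  ideal_gen setT J' = J -> generated_by A J' r -> mu A J' = mu setT J.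
Proof.
move=> hA muJ J'J hr; rewrite muJ; apply/muP; split=> // m hm.
by have [_] := (muP _ _ _).1 muJ; apply; rewrite -J'J; exact: generated_by_extend hm.
Qed.

End IdealTheory.
#[local] Hint Resolve subring_setT : core.

(** * Units of a quasilocal ring *)

Section Quasilocal.
Context (S : comNzRingType).

(** Zorn's lemma on the ideals that contain [u] but not [1]. *)
Lemma nonunit_in_maximal (u : S) : (forall v, u * v <> 1) ->
  exists M : set S, maximal_ideal M /\ M u.
Proof.
move=> u_nonunit.
pose good (N : set S) := [/\ ideal setT N, N u & ~ N 1].
(* The empty set is admitted only to have an upper bound for the empty
   chain. *)
pose P (N : set S) := N = set0 \/ good N.
have goodu : good (ideal_gen setT [set u]).
  split; [exact: ideal_gen_ideal|exact: mem_ideal_gen|] => h1.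
  have : [set v | exists a, v = u * a] 1.
    move: (1 : S) h1; apply: ideal_gen_min.
    + by exists 0; rewrite mulr0.
    + by move=> _ _ [a ->] [b ->]; exists (a + b); rewrite mulrDr.
    + by move=> a _ _ ->; exists a; rewrite mulrC.
  by case=> a /esym /u_nonunit.
have [|M [PM Mmax]] := @Zorn_bigcup S P.
  move=> F FP Ftot.
  have [[N0 [FN0 N0u]]|noF] := pselect (exists N, F N /\ N u); last first.
    left; apply/seteqP; split=> // x [N FN Nx]; case: (FP N FN) => [N0|[_ Nu _]].
      by rewrite N0 in Nx.
    by case: noF; exists N.
  have Fgood N x : F N -> N x -> good N.
    by move=> FN Nx; case: (FP N FN) => // NE; rewrite NE in Nx.
  right; split; first split=> //.
  - by exists N0 => //; case: (Fgood _ _ FN0 N0u) => -[].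
  - move=> x y [N FN Nx] [N' FN' Ny].
    have [[_ _ ND _] _ _] := Fgood _ _ FN Nx.
    have [[_ _ ND' _] _ _] := Fgood _ _ FN' Ny.
    case: (Ftot _ _ FN FN') => sub.
      by exists N' => //; apply: ND' => //; exact: sub.
    by exists N => //; apply: ND => //; exact: sub.
  - move=> a x _ [N FN Nx]; exists N => //.
    by have [[_ _ _ NM] _ _] := Fgood _ _ FN Nx; exact: NM.
  - by exists N0.
  - by case=> N FN N1; have [_ _] := Fgood _ _ FN N1; apply.
have goodM : good M.
  case: PM => // M0; case: (Mmax (ideal_gen setT [set u])); last by right.
  by rewrite M0; split=> // /(_ u); apply; case: goodu.
have [hM Mu M1] := goodM; exists M; split=> //; split=> //.
  by move=> MT; apply: M1; rewrite MT.
move=> N hN MN; have [N1|N1] := pselect (N 1); first by right; exact: ideal_1.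
left; apply: contrapT => NM; apply: (Mmax N).
  by split=> // NsubM; apply: NM; apply/seteqP.
by right; split=> //; exact: MN.
Qed.

(** Otherwise both [c] and [1 - c * a] would lie in the maximal ideal. *)
Lemma quasilocal_unit1B (c a : S) : quasilocal S ->
  (forall v, c * v <> 1) -> exists v, (1 - c * a) * v = 1.
Proof.
move=> [M [_ Muniq]] /nonunit_in_maximal[M1 [M1max M1c]].
apply: contrapT => h.
have [|M2 [M2max M2ca]] := @nonunit_in_maximal (1 - c * a).
  by move=> v hv; apply: h; exists v.
have eM : M2 = M1 by rewrite -(Muniq _ M1max) -(Muniq _ M2max).
rewrite eM in M2ca; case: M1max => hM M1T _; apply: M1T.
apply: ideal_1 => //; rewrite -[1](subrK (c * a)).
have [_ _ MD MM] := hM.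
by apply: MD => //; rewrite mulrC; exact: MM.
Qed.

End Quasilocal.

(** * Constants of a twisted subring *)

(** What the argument retains of a derivation [D] that twists [R], with [A] for
    the ring of the elements of [S] killed by [D]; it does not mention the
    module in which [D] takes its values. *)
Record ring_of_constants (S : comNzRingType) (C R A : set S) : Prop := {
  const_subring : subring A;
  const_sub : A `<=` R;
  const_denom : C `<=` A;
  const_split : forall c s, C c -> exists a t, A a /\ s = a + c * t;
  const_div : forall c t, C c -> A (c * t) -> A t;
  const_mul : forall c t t', C c -> R (c * t) -> R (c * t') -> R (c * (t * t'));
  const_unit : forall u v, R u -> u * v = 1 -> R v
}.

Section Constants.
Context (S : comNzRingType) (K : lmodType S) (C R : set S).
Context (SC : comNzRingType) (i : {rmorphism S -> SC}).
Context (KC : lmodType SC) (j : {linear K -> KC | i \; *:%R}).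

(** [const_mul] is the Leibniz rule
    [D (c t t') = t' D (c t) + t D (c t')], available because [D c = 0];
    [const_unit] is [D (u^-1) = - u^-2 D u]. *)
Lemma twisted_constants : is_ring_localization C i -> twisted C j R ->
  exists A, ring_of_constants C R A.
Proof.
move=> locC [D [[Dder DC] -> _ Dsplit]].
have D1 : D 1 = 0.
  by have := Dder 1 1; rewrite mulr1 scale1r => /eqP; rewrite -subr_eq subrr eq_sym => /eqP.
exists [set s | D (i s) = 0]; split.
- split=> [|x y /set_mem/= Dx /set_mem/= Dy|x y /set_mem/= Dx /set_mem/= Dy].
  + by apply: (@mem_set _ [set s | D (i s) = 0]); rewrite /= rmorph1 D1.
  + by apply: (@mem_set _ [set s | D (i s) = 0]); rewrite /= rmorphB raddfB Dx Dy subrr.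
  + by apply: (@mem_set _ [set s | D (i s) = 0]); rewrite /= rmorphM Dder Dx Dy !scaler0 addr0.
- by move=> s /= ->; exists 0 => //; rewrite raddf0.
- by move=> c /DC.
- move=> c s Cc; have [x [t [Dx sE]]] := Dsplit _ Cc s.
  exists (s - c * t), t; split; last by rewrite subrK.
  by rewrite /= rmorphB sE addrK.
- move=> c t Cc /=; rewrite rmorphM Dder (DC c Cc) scaler0 addr0 => h.
  have [u uc] := ring_loc_unit locC Cc.
  by rewrite -[LHS]scale1r -uc -scalerA h scaler0.
- move=> c t t' Cc /= [k _ kE] [k' _ kE'].
  exists (t' *: k + t *: k') => //.
  rewrite raddfD /= !linearZ /= kE kE' !rmorphM !Dder (DC c Cc) !scaler0 !addr0.
  by rewrite scalerDr !scalerA [RHS]addrC; congr (_ *: _ + _ *: _); ring.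
- move=> u v /= [k _ kE] uv; exists (- (v * v) *: k) => //.
  have iuv : i u * i v = 1 by rewrite -rmorphM uv rmorph1.
  have := Dder (i u) (i v); rewrite iuv D1 => /esym/(congr1 (fun y => i v *: y)).
  rewrite scaler0 scalerDr !scalerA [i v * i u]mulrC iuv scale1r => /eqP.
  rewrite addr_eq0 => /eqP ->.
  by rewrite linearZ /= kE rmorphN rmorphM scaleNr.
Qed.

End Constants.

(** * Reductions of contracted ideals *)

Lemma mulr_closedX (S : comNzRingType) (C : set S) c m :
  mulr_closed (mem C) -> C c -> C (c ^+ m).
Proof.
move=> [C1 CM] Cc; elim: m => [|m IHm]; first by move/set_mem: C1.
by rewrite exprS; exact: set_mem (CM c _ (mem_set Cc) (mem_set IHm)).
Qed.

Section Reduction.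
Context (S : comNzRingType) (C R A I : set S).
Context (hR : subring R) (hA : ring_of_constants C R A).
Context (hI : ideal R I) (Icontr : contracted R I).

Let IS := ideal_gen setT I.
Let IR : I `<=` R. Proof. by case: hI. Qed.
Let hIS : ideal setT IS. Proof. exact: ideal_gen_ideal. Qed.
Let IIS : I `<=` IS. Proof. by move=> x Ix; exact: mem_ideal_gen. Qed.

(** This is how the contraction hypothesis enters: constants of [IS] need no
    correction to be in [I]. *)
Lemma extension_constant x : IS x -> A x -> I x.
Proof. by move=> ISx Ax; rewrite Icontr; split=> //; exact: (const_sub hA). Qed.

Lemma extension_split e x : C e -> IS e -> IS x ->
  exists a t, [/\ A a, I a & x = a + e * t].
Proof.
move=> Ce ISe ISx; have [a [t [Aa xE]]] := const_split hA x Ce.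
exists a, t; split=> //; apply: extension_constant => //.
have -> : a = x - e * t by rewrite xE addrK.
apply: idealB => //; rewrite mulrC.
by case: hIS => _ _ _; apply.
Qed.

Lemma extension_exp_split e m : C e -> I e ->
  ideal_exp setT IS m `<=`
    [set x | exists a t, [/\ A a, ideal_exp R I m a & x = a + e * t]].
Proof.
move=> Ce Ie; have sA := const_subring hA; elim: m => [|m IHm] /=.
  move=> x _; have [a [t [Aa xE]]] := const_split hA x Ce.
  by exists a, t; split=> //; exact: (const_sub hA).
have [_ E0 ED EM] := ideal_exp_ideal m.+1 hR hI.
apply: ideal_gen_min.
- exists 0, 0; split=> //; last by rewrite mulr0 addr0.
  exact: subring0.
- move=> _ _ [a [t [Aa Ea ->]]] [b [u [Ab Eb ->]]]; exists (a + b), (t + u).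
  by split; [exact: subringD|exact: ED|ring].
- move=> s _ _ [x ISx [y Ey <-]].
  have [a [t [Aa Ia ->]]] := extension_split Ce (IIS Ie) ISx.
  have [b [u [Ab Eb ->]]] := IHm _ Ey.
  have [d [v [Ad ->]]] := const_split hA s Ce.
  (* Expand (d + e v)(a + e t)(b + e u) modulo e. *)
  exists (d * (a * b)), (v * (a + e * t) * (b + e * u) + d * (a * u + t * (b + e * u))).
  split; [by apply: subringM => //; exact: subringM| |ring].
  by apply: EM; [exact: (const_sub hA)|exact: mem_ideal_mul].
Qed.

(** Write two elements of [I] as [a + e t] and [b + e u] with [a], [b]
    constants of [I]. In their product the term [e t * e u] is [e] times an
    element of [R], although [t] and [u] need not be in [R]: at most one
    factor of a product matters beyond its constant part modulo [e R]. *)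
Lemma exp_sub_of_constants e m T : C e -> I e -> ideal R T -> T e ->
  (forall p z, A p -> ideal_exp R I m p -> I z -> T (p * z)) ->
  ideal_exp R I m.+1 `<=` T.
Proof.
move=> Ce Ie; have sA := const_subring hA; elim: m T => [|m IHm] T hT Te TM.
  apply: sub_ideal_mul => // x y Ix Ry; rewrite mulrC -[y * x]mul1r.
  apply: TM; [exact: subring1|exact: subring1|].
  by case: hI => _ _ _; apply.
apply: sub_ideal_mul => // x y Ix; have [TR T0 TD TZ] := hT.
have [a [t [Aa Ia xE]]] := extension_split Ce (IIS Ie) (IIS Ix).
have Iet : I (e * t).
  have -> : e * t = x - a by rewrite xE; ring.
  exact: idealB hI Ix Ia.
(* The induction hypothesis applies to the colon ideal of T by x. *)
move: y; suff: ideal_exp R I m.+1 `<=` [set y | R y /\ T (x * y)].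
  by move=> sub y /sub[].
apply: IHm => /=.
- split=> /=.
  + by move=> y [].
  + by rewrite mulr0; split=> //; exact: subring0.
  + by move=> y z [Ry Ty] [Rz Tz]; rewrite mulrDr; split; [exact: subringD|exact: TD].
  + by move=> r y Rr [Ry Ty]; rewrite mulrCA; split; [exact: subringM|exact: TZ].
- by split; [exact: IR|apply: TZ => //; exact: IR].
move=> p z Ap Ep Iz; have Rp := const_sub hA Ap.
split; first by apply: subringM => //; exact: IR.
have [b [u [Ab Ib zE]]] := extension_split Ce (IIS Ie) (IIS Iz).
have Ieu : I (e * u).
  have -> : e * u = z - b by rewrite zE; ring.
  exact: idealB hI Iz Ib.
have Epa : ideal_exp R I m.+1 (a * p) by exact: mem_ideal_mul.
have Epb : ideal_exp R I m.+1 (b * p) by exact: mem_ideal_mul.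
have -> : x * (p * z) = a * p * z + b * p * (e * t) + p * (e * (t * u)) * e.
  by rewrite xE zE; ring.
apply: (TD); first apply: TD.
- by apply: TM => //; exact: subringM.
- by apply: TM => //; exact: subringM.
- apply: TZ => //; apply: subringM => //.
  by apply: (const_mul hA) => //; exact: IR.
Qed.

Context (r : nat) (x : 'I_r -> S) (n : nat).
Context (Ax : forall k, A (x k)) (Ix : forall k, I (x k)).
Context (xred : ideal_exp setT IS n.+1 `<=`
  ideal_mul setT (ideal_gen setT (range x)) (ideal_exp setT IS n)).

Let J' := ideal_gen R (range x).

Let J'I : J' `<=` I.
Proof. by apply: sub_ideal_gen => // _ [k _ <-]. Qed.

Let hJI : ideal R (ideal_mul R J' (ideal_exp R I n.+1)).
Proof.
apply: ideal_mul_ideal => //; first exact: subset_trans IR.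
by case: (ideal_exp_ideal n.+1 hR hI).
Qed.

(** A constant of [I^(n+1)] is a combination of the [x k] with coefficients in
    [(IS)^n]; splitting these leaves [e] times an element of [S], which is a
    constant because the other terms of the equation are. *)
Lemma exp_sub_reduction_modulo e : C e -> I e ->
  ideal_exp R I n.+2 `<=`
    [set w + e * s | w in ideal_mul R J' (ideal_exp R I n.+1) & s in R].
Proof.
move=> Ce Ie; have sA := const_subring hA.
apply: (exp_sub_of_constants (e := e)) => //.
- by apply: ideal_add_principal => //; exact: IR.
- exists 0; first by case: hJI.
  by exists 1; [exact: subring1|rewrite add0r mulr1].
move=> p z Ap Ep Iz.
have /xred/ideal_mul_rangeP[//||w [Ew pE]] : ideal_exp setT IS n.+1 p.
- by apply: ideal_exp_sub Ep.
- exact: ideal_exp_ideal.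
have /choice[a /choice[t atP]] k : exists a t,
    [/\ A a, ideal_exp R I n a & w k = a + e * t].
  exact: extension_exp_split (Ew k).
have pE' : p = \sum_k x k * a k + e * \sum_k x k * t k.
  rewrite pE mulr_sumr -big_split; apply: eq_bigr => k _ /=.
  by have [_ _ ->] := atP k; ring.
have At : A (\sum_k x k * t k).
  apply: (const_div hA Ce).
  have -> : e * (\sum_k x k * t k) = p - \sum_k x k * a k by rewrite {1}pE'; ring.
  apply: subringB => //; apply: ideal_sum (subring_ideal sA) _ => k.
  by apply: subringM => //; case: (atP k).
exists (\sum_k x k * (z * a k)).
  apply: ideal_sum hJI _ => k; apply: mem_ideal_mul => //.
    by apply: mem_ideal_gen => //; exists k.
  by apply: mem_ideal_mul => //; case: (atP k).
exists ((\sum_k x k * t k) * z).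
  by apply: subringM => //; [exact: (const_sub hA)|exact: IR].
rewrite pE' [RHS]mulrDl mulrA; congr (_ + _).
by rewrite mulr_suml; apply: eq_bigr => k _; ring.
Qed.

(** Modulo [c^(n+3)] the element [c^(n+2)] of [I^(n+2)] lies in
    [J' I^(n+1)], that is, [c^(n+2) (1 - c s)] lies there for some [s] in [R].
    As [1 - c s] is invertible in [R], so does [c^(n+2)], and the error terms
    [c^(n+3) R] are absorbed. *)
Lemma exp_eq_reduction c : mulr_closed (mem C) -> C c -> I c ->
  (forall s, exists v, (1 - c * s) * v = 1) ->
  ideal_exp R I n.+2 = ideal_mul R J' (ideal_exp R I n.+1).
Proof.
move=> Cmul Cc Ic unit1B; have [_ _ JD JM] := hJI.
have CX m : C (c ^+ m) by exact: mulr_closedX.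
have Rc := IR Ic.
have Ie : I (c ^+ n.+3).
  rewrite exprSr; case: hI => _ _ _; apply => //.
  exact/(const_sub hA)/(const_denom hA).
have sub := exp_sub_reduction_modulo (CX n.+3) Ie.
have JIc : ideal_mul R J' (ideal_exp R I n.+1) (c ^+ n.+2).
  have [w Jw [s Rs wE]] := sub _ (mem_ideal_exp n.+2 hR Ic).
  have [v uv] := unit1B s.
  have -> : c ^+ n.+2 = v * w.
    have -> : w = c ^+ n.+2 * (1 - c * s).
      by rewrite mulrBr mulr1 mulrA -exprSr -{1}wE addrK.
    by rewrite mulrC -mulrA uv mulr1.
  apply: JM => //; apply: (const_unit hA) uv.
  by apply: subringB => //; [exact: subring1|exact: subringM].
apply/seteqP; split=> [y /sub[w Jw [s Rs <-]]|].
  apply: JD => //; rewrite exprS mulrAC; apply: JM; last exact: JIc.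
  exact: subringM.
apply: sub_ideal_mul; first exact: (ideal_exp_ideal n.+2).
by move=> y z /J'I Iy Ez; exact: mem_ideal_mul.
Qed.

End Reduction.

(** If [w = \sum_k a k * x k], then
    [\sum_k a k * (x k - c * w * t k) = (1 - c * \sum_k a k * t k) * w], so
    [w], and with it every [x k], is in the ideal of the perturbed
    generators. *)
Lemma ideal_gen_perturb (S : comNzRingType) r (x x' t : 'I_r -> S) (c w : S) :
  ideal_gen setT (range x) w -> (forall k, x k = x' k + c * w * t k) ->
  (forall s, exists v, (1 - c * s) * v = 1) ->
  ideal_gen setT (range x') = ideal_gen setT (range x).
Proof.
move=> xw xE unit1B.
have hx := ideal_gen_ideal (@subring_setT S) (@subsetT _ (range x)).
have hx' := ideal_gen_ideal (@subring_setT S) (@subsetT _ (range x')).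
have [_ _ XD' XM'] := hx'; have [_ _ _ XM] := hx.
have x'gen k : ideal_gen setT (range x') (x' k) by apply: mem_ideal_gen => //; exists k.
have xgen k : ideal_gen setT (range x) (x k) by apply: mem_ideal_gen => //; exists k.
have x'w : ideal_gen setT (range x') w.
  have [a [_ wE]] := ideal_gen_rangeP (@subring_setT S) xw.
  have [v uv] := unit1B (\sum_k a k * t k).
  have -> : w = v * \sum_k a k * x' k.
    have -> : \sum_k a k * x' k = (1 - c * \sum_k a k * t k) * w.
      rewrite mulrBl mul1r {1}wE -mulrA mulr_suml mulr_sumr -sumrB.
      by apply: eq_bigr => k _; rewrite xE; ring.
    by rewrite mulrA [v * _]mulrC uv mul1r.
  by apply: (XM') => //; apply: ideal_sum hx' _ => k; exact: XM'.
apply/seteqP; split; apply: sub_ideal_gen => // _ [k _ <-].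
  have -> : x' k = x k - c * t k * w by rewrite xE; ring.
  by apply: idealB => //; exact: XM.
by rewrite xE; apply: XD' => //; rewrite mulrAC; exact: XM'.
Qed.

Theorem theorem3p1 (S : comNzRingType) (K : lmodType S) (C R : set S)
    (SC : comNzRingType) (i : {rmorphism S -> SC})
    (KC : lmodType SC) (j : {linear K -> KC | i \; *:%R})
    (I : set S) (n : nat) :
  quasilocal S ->
  mulr_closed (mem C) ->
  (forall c, C c -> GRing.lreg c) ->
  (forall c, C c -> injective (fun k : K => c *: k)) ->
  is_ring_localization C i ->
  is_module_localization C j ->
  subring R ->
  twisted C j R ->
  ideal R I ->
  contracted R I ->
  I `&` C !=set0 ->
  (0 < n)%N ->
  let IS := ideal_gen setT I in
  forall J : set S,
    ideal setT J -> fin_gen setT J -> J `<=` IS ->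
    ideal_exp setT IS n.+1 = ideal_mul setT J (ideal_exp setT IS n) ->
  exists J' : set S,
    [/\ ideal R J', J' `<=` I,
        ideal_exp R I n.+2 = ideal_mul R J' (ideal_exp R I n.+1) &
        mu R J' = mu setT J].
Proof.
move=> hS Cmul _ _ locC _ hR /(twisted_constants locC)[A hA] hI Icontr [c [Ic Cc]] _.
move=> IS J hJ Jfg JIS Jred.
have hIS : ideal setT IS by exact: ideal_gen_ideal.
have ISc : IS c by exact: mem_ideal_gen.
have [r muJ] : exists r, mu setT J = Some r.
  by rewrite /mu; case: pselect => // h; case: ex_minnP => r _ _; exists r.
have [[x [Jx JE]] _] := (muP _ _ _).1 muJ.
have Jc : J (c ^+ n.+1).
  have : ideal_exp setT IS n.+1 (c ^+ n.+1) by exact: mem_ideal_exp.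
  rewrite Jred; apply: sub_ideal_mul => // y z Jy _.
  by rewrite mulrC; case: hJ => _ _ _; apply.
(* If c is invertible in S, then I = R and J = S. *)
have [[v cv]|c_nonunit] := pselect (exists v, c * v = 1).
  have IR : I = R.
    apply: ideal_1 => //; rewrite -cv mulrC.
    have [sIR _ _ IM] := hI; apply: IM => //.
    by apply: (const_unit hA) cv; exact: sIR.
  have J1 : J 1.
    have -> : 1 = v ^+ n.+1 * c ^+ n.+1 by rewrite -exprMn mulrC cv expr1n.
    by case: hJ => _ _ _; apply.
  have r_gt0 : (0 < r)%N.
    case: r muJ x Jx JE => // _ x _ JE; move: J1; rewrite JE.
    move=> /(ideal_gen_rangeP (@subring_setT S))[a [_ /eqP]].
    by rewrite big_ord0 oner_eq0.
  exists R; split; first exact: subring_ideal.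
  - by rewrite IR.
  - by rewrite IR [RHS](ideal_exp_setT n.+2 hR) ideal_exp_setT.
  have R1 : R 1 by exact: subring1.
  apply: (mu_extension hR muJ).
    rewrite (ideal_1 hJ J1); apply: ideal_1; first exact: ideal_gen_ideal.
    exact: mem_ideal_gen.
  (* R is generated by r copies of 1, a minimal number since mu_S(S) = r. *)
  exists (fun=> 1); split=> //; apply/esym/ideal_1.
    by apply: ideal_gen_ideal => // _ [_ _ <-].
  by apply: mem_ideal_gen => //; exists (Ordinal r_gt0).
have unit1B s : exists v, (1 - c * s) * v = 1.
  by apply: quasilocal_unit1B => // v cv; apply: c_nonunit; exists v.
have CX m : C (c ^+ m) by exact: mulr_closedX.
(* One power of c beyond c^(n+1), which is in J, makes the change of generators
   invertible. *)
have /choice[x' /choice[t xP]] k : exists a t,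
    [/\ A a, I a & x k = a + c ^+ n.+2 * t].
  apply: (extension_split hA) => //; last exact/JIS.
  by rewrite exprSr; case: hIS => _ _ _; apply.
have J'E : ideal_gen setT (range x') = J.
  rewrite JE; apply: (@ideal_gen_perturb _ _ _ _ t c (c ^+ n.+1)) => //.
    by rewrite -JE.
  by move=> k; rewrite -exprS; case: (xP k).
have x'I k : I (x' k) by case: (xP k).
have J'I : ideal_gen R (range x') `<=` I by apply: sub_ideal_gen => // _ [k _ <-].
have IR : I `<=` R by case: hI.
have J'x k : ideal_gen R (range x') (x' k) by apply: mem_ideal_gen => //; exists k.
exists (ideal_gen R (range x')); split=> //.
- by apply: ideal_gen_ideal => // _ [k _ <-]; exact: IR.
- apply: (exp_eq_reduction hR hA hI Icontr _ x'I _ Cmul Cc Ic unit1B).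
    by move=> k; case: (xP k).
  by rewrite J'E Jred.
apply: (mu_extension hR muJ); last by exists x'.
by rewrite -J'E; exact: ideal_gen_extend.
Qed.
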